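(* Let $p=0.34$. For every sequence $(a_n)_{n\ge1}$ of non-negative real numbers, $$\sum_{n=1}^{\infty}\left(\frac1n\sum_{k=n}^\infty a_k\right)^{p}\ge\left(\frac{p}{1-p}\right)^p\sum_{n=1}^\infty a_n^{p}.$$
   Context: Sums of non-negative terms are understood as elements of $[0,\infty]$; if $\sum_k a_k$ diverges, the left-hand side is $+\infty$ and the inequality is trivially true. *)

(* Defs.v *)
From mathcomp Require Export all_boot all_order all_algebra.
From mathcomp Require Export all_classical all_reals all_analysis.

(* Main.v *)
(** Writing A_n for the tail sum from n, so that a_n = A_n - A_(n+1), one looks
    for a potential: weights w_n >= 0 with w_1 = 0 and
      r^(1-p) a_n^p + w_(n+1) A_(n+1)^p <= (r n^(-p) + w_n) A_n^p,
    where r = (1-p)/p; summed over n, the potential terms telescope away.  With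
    w_n = x_n^(1-p), Hoelder's inequality reduces this to
      (x_(n+1) + r)^(1-p) <= r n^(-p) + x_n^(1-p).
    We take x_n = n - g for n >= 2, with g = 1.21 < 1/(2p).  After division by
    n^(1-p) the condition becomes F(1/n) >= 0, where
      F(y) = r y + (1 - g y)^(1-p) - (1 + (1/p - g) y)^(1-p).
    Here F(0) = 0 and F' is concave with F'(0) = 0, so F(l y) >= l^2 F(y) for
    0 <= l <= 1, and the numerical fact F(1/2) >= 0 settles every n >= 2. *)

Require Import Defs.
From mathcomp Require Import all_boot all_order all_algebra.
From mathcomp Require Import all_classical all_reals all_analysis.
From mathcomp Require Import ring lra.
Import Order.TTheory GRing.Theory Num.Theory.
Local Open Scope ring_scope.

(** * Convexity of negative powers *)

Lemma powRN_ge_tangent (R : realType) (q x : R) :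
  0 <= q -> 0 < x -> 1 - q * (x - 1) <= x `^ (- q).
Proof.
move=> q0 x0; rewrite /powR gt_eqF//.
apply: le_trans (expR_ge1Dx _).
have : ln x <= x - 1 by rewrite -{1}[x](subrKC 1) le_ln1Dx//; lra.
by move=> /(ler_wpM2l q0); lra.
Qed.

(** The tangent at the weighted mean [m] of 1 and [1 + t] lies below the power at both points; with
    weights [1 - l] and [l] the slope terms cancel. This is the source of the concavity of F'. *)
Lemma powRN_convex_from1 (R : realType) (q l t : R) : 0 <= q -> 0 <= l <= 1 -> -1 < t ->
  (1 + l * t) `^ (- q) <= 1 - l + l * (1 + t) `^ (- q).
Proof.
move=> q0 /andP[l0 l1] t1.
have m0 : 0 < 1 + l * t.
  have [->|ln0] := eqVneq l 0; first by lra.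
  have lt0 : 0 < l * (1 + t) by rewrite mulr_gt0 ?lt0r ?ln0//; lra.
  lra.
set m := 1 + l * t in m0 *.
have tangent x : 0 < x -> m `^ (- q) * (1 - q * (x / m - 1)) <= x `^ (- q).
  move=> x0; have xm0 : 0 < x / m by rewrite divr_gt0.
  have -> : x `^ (- q) = m `^ (- q) * (x / m) `^ (- q).
    by rewrite -powRM ?ltW// mulrC divfK ?lt0r_neq0.
  by rewrite ler_wpM2l ?powR_ge0// powRN_ge_tangent.
have h1 := tangent 1 ltr01.
have ht : m `^ (- q) * (1 - q * ((1 + t) / m - 1)) <= (1 + t) `^ (- q).
  by apply: tangent; lra.
rewrite powR1 in h1.
have l1' : 0 <= 1 - l by lra.
have := lerD (ler_wpM2l l1' h1) (ler_wpM2l l0 ht).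
rewrite mulr1; apply: le_trans.
rewrite le_eqVlt; apply/orP; left; apply/eqP.
rewrite /m; field; exact: lt0r_neq0.
Qed.

(** * Hoelder's inequality and the potential for truncated sums *)

Lemma powR_hoelder2 (R : realType) (p s x a b : R) : 0 < p < 1 ->
  0 <= s -> 0 <= x -> 0 <= a -> 0 <= b ->
  s `^ (1 - p) * a `^ p + x `^ (1 - p) * b `^ p
    <= (s + x) `^ (1 - p) * (a + b) `^ p.
Proof.
move=> /andP[p0 p1] s0 x0 a0 b0.
have q0 : 0 < 1 - p by lra.
have := @hoelder2 R (s `^ (1 - p)) (x `^ (1 - p)) (a `^ p) (b `^ p)
  (1 - p)^-1 p^-1 (powR_ge0 _ _) (powR_ge0 _ _) (powR_ge0 _ _) (powR_ge0 _ _).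
rewrite !invr_gt0 !invrK -!powRrM !mulfV ?lt0r_neq0// !powRr1//.
by apply=> //; ring.
Qed.

Lemma sum_powR_tail_ge (R : realType) (p : R) (x a : nat -> R) (N : nat) :
  0 < p < 1 -> x 1%N = 0 -> (forall n, 0 <= x n) ->
  (forall n, (1 <= n)%N -> (x n.+1 + (1 - p) / p) `^ (1 - p)
     <= (1 - p) / p * n%:R `^ (- p) + x n `^ (1 - p)) ->
  (forall n, (1 <= n)%N -> 0 <= a n) ->
  (p / (1 - p)) `^ p * \sum_(1 <= n < N) a n `^ p
    <= \sum_(1 <= n < N) (n%:R^-1 * \sum_(n <= k < N) a k) `^ p.
Proof.
move=> p01 x1 x0 xS a0.
have /andP[p0 p1] := p01.
have q0 : 0 < 1 - p by lra.
case: N => [|N]; first by rewrite !big_geq// mulr0.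
set r := (1 - p) / p in xS.
have r0 : 0 < r by rewrite divr_gt0.
pose T n := \sum_(n <= k < N.+1) a k.
have T0 n : (1 <= n)%N -> 0 <= T n.
  move=> n1; rewrite /T big_nat_cond sumr_ge0// => i; rewrite andbT => /andP[ni _].
  exact/a0/(leq_trans n1).
pose w n := x n `^ (1 - p) * T n `^ p.
have step n : (1 <= n < N.+1)%N ->
    r `^ (1 - p) * a n `^ p <= r * (n%:R^-1 * T n) `^ p - (w n.+1 - w n).
  move=> /andP[n1 nN].
  have -> : (n%:R^-1 * T n) `^ p = n%:R `^ (- p) * T n `^ p.
    by rewrite powRM ?invr_ge0 ?T0// powRN -powR_inv1// powRAC powR_inv1 ?powR_ge0.
  have TS : T n = a n + T n.+1 by rewrite /T big_ltn.
  have H := @powR_hoelder2 R p r (x n.+1) (a n) (T n.+1) p01 (ltW r0) (x0 _)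
    (a0 _ n1) (T0 _ (leqW n1)).
  have /(ler_wpM2r (powR_ge0 (T n) p)) := xS _ n1.
  rewrite -TS addrC in H.
  rewrite [r + _]addrC in H.
  rewrite /w; lra.
have key : r `^ (1 - p) * \sum_(1 <= n < N.+1) a n `^ p
    <= r * \sum_(1 <= n < N.+1) (n%:R^-1 * T n) `^ p.
  rewrite !mulr_sumr.
  apply: le_trans (ler_sum_nat step) _.
  rewrite sumrB telescope_sumr// /w x1 powR0 ?lt0r_neq0// mul0r subr0.
  by rewrite gerBl mulr_ge0 ?powR_ge0.
(* The constant of the theorem is r^(-p), so multiplying by r turns it into r^(1-p). *)
rewrite -(ler_pM2l r0) mulrA.
suff -> : r * (p / (1 - p)) `^ p = r `^ (1 - p) by [].
have -> : p / (1 - p) = r^-1 by rewrite /r invf_div.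
rewrite -powR_inv1 ?ltW// -powRrM mulN1r powRD ?powRr1 ?ltW//.
by rewrite lt0r_neq0// implybT.
Qed.

(** * From truncated sums to series *)

Lemma nneseries_powR_tail_ge (R : realType) (p C : R) (a : nat -> R) :
  0 <= p -> 0 <= C -> (forall n, (1 <= n)%N -> 0 <= a n) ->
  (forall N, C * \sum_(1 <= n < N) a n `^ p
     <= \sum_(1 <= n < N) (n%:R^-1 * \sum_(n <= k < N) a k) `^ p) ->
  (C%:E * \sum_(1 <= n <oo) ((a n) `^ p)%:E
   <= \sum_(1 <= n <oo)
        ((n%:R^-1)%:E * \sum_(n <= k <oo) (a k)%:E) `^ p)%E.
Proof.
move=> p0 C0 a0 H.
rewrite -nneseriesZl; last by move=> n _; rewrite lee_fin powR_ge0.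
(* The limit is taken on the left only: on the right, the outer sum and the inner tails can only
   grow when extended to infinity. *)
apply: lime_le.
  by apply: is_cvg_nneseries => n _ _; rewrite -EFinM lee_fin mulr_ge0 ?powR_ge0.
apply: nearW => N.
apply: le_trans (nneseries_lim_ge N _); last by move=> n _ _; exact: poweR_ge0.
have -> : (\sum_(1 <= n < N) C%:E * (a n `^ p)%:E)%E =
    (C * \sum_(1 <= n < N) a n `^ p)%:E.
  by rewrite mulr_sumr -sumEFin.
apply: (@le_trans _ _ (\sum_(1 <= n < N) (n%:R^-1 * \sum_(n <= k < N) a k) `^ p)%:E).
  by rewrite lee_fin.
rewrite -sumEFin big_nat_cond [leRHS]big_nat_cond; apply: lee_sum => n.
rewrite andbT => /andP[n1 nN].
have ak k : (n <= k)%N -> 0 <= a k by move=> nk; apply/a0/(leq_trans n1).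
have T0 : 0 <= \sum_(n <= k < N) a k.
  by rewrite big_nat_cond sumr_ge0// => k; rewrite andbT => /andP[/ak].
have S0 : (0 <= \sum_(n <= k <oo) (a k)%:E)%E.
  by apply: nneseries_ge0 => k nk _; rewrite lee_fin ak.
rewrite -poweR_EFin; apply: gt0_ler_poweR => //.
- by rewrite in_itv/= leey andbT lee_fin mulr_ge0 ?invr_ge0.
- by rewrite in_itv/= leey andbT mule_ge0// lee_fin invr_ge0.
rewrite EFinM lee_pmul2l ?lte_fin ?invr_gt0 ?ltr0n//.
rewrite -sumEFin; apply: nneseries_lim_ge => k nk _.
by rewrite lee_fin ak.
Qed.

(** * The function F and its quadratic scaling *)

Definition defect {R : realType} (p g y : R) : R :=
  (1 - p) / p * y + (1 + - g * y) `^ (1 - p) - (1 + (p^-1 - g) * y) `^ (1 - p).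

Lemma is_derive_powR_affine (R : realType) (q c y : R) : 0 < 1 + c * y ->
  is_derive y 1 (fun z : R => (1 + c * z) `^ q) (q * (1 + c * y) `^ (q - 1) * c).
Proof.
move=> cy0.
have ? := @is_derive1_powR R q _ cy0.
have ? : is_derive y 1 (fun z : R => 1 + c * z) c.
  by apply: is_derive_eq; rewrite /GRing.scale/=; ring.
exact: (@is_derive1_comp _ (@powR R ^~ q) (fun z : R => 1 + c * z)).
Qed.

Lemma is_derive_defect (R : realType) (p g y : R) : p != 0 ->
  0 < 1 + - g * y -> 0 < 1 + (p^-1 - g) * y ->
  is_derive y 1 (defect p g)
   ((1 - p) * (p^-1 - g * (1 + - g * y) `^ (- p)
     - (p^-1 - g) * (1 + (p^-1 - g) * y) `^ (- p))).
Proof.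
move=> p0 gy by0.
have ? := @is_derive_powR_affine R (1 - p) _ _ gy.
have ? := @is_derive_powR_affine R (1 - p) _ _ by0.
apply: is_derive_eq.
have -> : 1 - p - 1 = - p by ring.
rewrite /GRing.scale/=.
by field.
Qed.

Lemma defect_ge_scale (R : realType) (p g y l : R) : 0 < p < 1 ->
  0 <= g <= p^-1 -> 0 <= y -> g * y < 1 -> 0 <= l <= 1 ->
  l ^+ 2 * defect p g y <= defect p g (l * y).
Proof.
move=> /andP[p0 p1] /andP[g0 gp] y0 gy1 /andP[l0 l1].
have q0 : 0 < 1 - p by lra.
have b0 : 0 <= p^-1 - g by lra.
(* With [h] = F', [D] vanishes at 0 and has derivative l (h(l z) - l h(z)), so it suffices that l
   h(z) <= h(l z). *)
pose D z := defect p g (l * z) - l ^+ 2 * defect p g z.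
pose h z := (1 - p) * (p^-1 - g * (1 + - g * z) `^ (- p)
  - (p^-1 - g) * (1 + (p^-1 - g) * z) `^ (- p)).
have gz z : 0 <= z <= y -> 0 < 1 + - g * z.
  by move=> /andP[z0 zy]; have := ler_wpM2l g0 zy; lra.
have bz z : 0 <= z <= y -> 0 < 1 + (p^-1 - g) * z.
  by move=> /andP[z0 zy]; have := mulr_ge0 b0 z0; lra.
have lz z : 0 <= z <= y -> 0 <= l * z <= y.
  by move=> /andP[z0 zy]; rewrite mulr_ge0//= (le_trans _ zy)// ler_piMl.
have dD z : 0 <= z <= y -> is_derive z 1 D (h (l * z) * l - l ^+ 2 * h z).
  move=> zy.
  have ? := @is_derive_defect R p g z (lt0r_neq0 p0) (gz _ zy) (bz _ zy).
  have H := @is_derive_defect R p g (l * z) (lt0r_neq0 p0)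
    (gz _ (lz _ zy)) (bz _ (lz _ zy)).
  have ? : is_derive z 1 (fun z : R => l * z) l.
    by apply: is_derive_eq; rewrite /GRing.scale/=; ring.
  have ? := @is_derive1_comp _ (defect p g) (fun z : R => l * z) _ _ _ H _.
  by apply: is_derive_eq; rewrite /GRing.scale/=.
have hl z : 0 <= z <= y -> l * h z <= h (l * z).
  move=> zy; rewrite /h.
  have l01 : 0 <= l <= 1 by rewrite l0.
  have gz' : -1 < - g * z by have := gz _ zy; lra.
  have bz' : -1 < (p^-1 - g) * z by have := bz _ zy; lra.
  (* Weighted by g and 1/p - g, the constants 1 - l of the two convexity bounds add up to (1 - l)/p,
     leaving exactly l/p in [h]. *)
  have := ler_wpM2l g0 (@powRN_convex_from1 R p l _ (ltW p0) l01 gz').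
  have := ler_wpM2l b0 (@powRN_convex_from1 R p l _ (ltW p0) l01 bz').
  rewrite (mulrCA l (- g)) (mulrCA l (p^-1 - g)) (mulrCA l (1 - p)) => h1 h2.
  by rewrite ler_pM2l//; lra.
have oo z : z \in `]0, y[ -> 0 <= z <= y.
  by rewrite in_itv/= => /andP[/ltW -> /ltW].
have D0y : D 0 <= D y.
  apply: (@ger0_derive1_ndecr R D 0 y _ _ _ 0 y (lexx _) y0 (lexx _)).
  - move=> z /oo zy; exact: (@ex_derive _ _ _ _ _ _ _ (dD z zy)).
  - move=> z /oo zy; rewrite derive1E (@derive_val _ _ _ _ _ _ _ (dD z zy)).
    by have := ler_wpM2l l0 (hl _ zy); lra.
  apply: derivable_within_continuous => z; rewrite in_itv/= => zy.
  exact: (@ex_derive _ _ _ _ _ _ _ (dD z zy)).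
have D0 : D 0 = 0 by rewrite /D mulr0 /defect !mulr0 !addr0 powR1; ring.
by move: D0y; rewrite D0 /D subr_ge0.
Qed.

(** * Numerical verification and the weights for p = 0.34 *)

Lemma powR_frac_le (R : realType) (x y : R) (k m : nat) : (0 < m)%N ->
  0 <= x -> 0 <= y -> x ^+ k <= y ^+ m -> x `^ (k%:R / m%:R) <= y.
Proof.
move=> m0 x0 y0 /(@ge0_ler_powR R m%:R^-1 _ (x ^+ k) (y ^+ m)).
rewrite !nnegrE !exprn_ge0// => /(_ _ isT isT).
rewrite -!powR_mulrn// -!powRrM divff ?pnatr_eq0 -?lt0n// powRr1//.
by apply; rewrite invr_ge0.
Qed.

Lemma powR_frac_ge (R : realType) (x y : R) (k m : nat) : (0 < m)%N ->
  0 <= x -> 0 <= y -> y ^+ m <= x ^+ k -> y <= x `^ (k%:R / m%:R).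
Proof.
move=> m0 x0 y0 /(@ge0_ler_powR R m%:R^-1 _ (y ^+ m) (x ^+ k)).
rewrite !nnegrE !exprn_ge0// => /(_ _ isT isT).
rewrite -!powR_mulrn// -!powRrM divff ?pnatr_eq0 -?lt0n// powRr1//.
by apply; rewrite invr_ge0.
Qed.

Lemma defect_half_ge0 (R : realType) : 0 <= defect (34 / 100) (121 / 100) (2^-1 : R).
Proof.
rewrite /defect.
have -> : 1 - 34 / 100 = 33%:R / 50%:R :> R by field.
(* Since r/2 > 0.9705, the bounds 0.541 and 1.51 suffice; each is a comparison of a 33rd with a 50th
   power of rationals. *)
have B : 541 / 1000 <= (1 + - (121 / 100) * 2^-1 : R) `^ (33%:R / 50%:R).
  by apply: powR_frac_ge; [by []|lra..].
have C : (1 + ((34 / 100)^-1 - 121 / 100) * 2^-1 : R) `^ (33%:R / 50%:R) <= 151 / 100.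
  have -> : 1 + ((34 / 100)^-1 - 121 / 100) * 2^-1 = 6343 / 3400 :> R by field.
  by apply: powR_frac_le; [by []|lra..].
lra.
Qed.

(* For [n = 2], any value [2 - g] with [g >= 1.2093] satisfies the condition
   coming from [n = 1]; [g = 1.21] still has [F(1/2) > 0], by a margin of 0.003. *)
Definition weight {R : realType} (n : nat) : R :=
  if (n < 2)%N then 0 else n%:R - 121 / 100.

Lemma weight_ge0 (R : realType) (n : nat) : 0 <= weight n :> R.
Proof.
rewrite /weight; case: ltnP => [|n2]; first by [].
have : 2 <= n%:R :> R by rewrite ler_nat.
lra.
Qed.

Lemma weight_step (R : realType) (p : R) (n : nat) : p = 34 / 100 -> (1 <= n)%N ->
  (weight n.+1 + (1 - p) / p) `^ (1 - p)
    <= (1 - p) / p * n%:R `^ (- p) + weight n `^ (1 - p).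
Proof.
move=> hp; rewrite leq_eqVlt => /predU1P[<-|n2].
  rewrite /weight/= powR1 mulr1 hp powR0; last by apply/eqP; lra.
  have -> : 1 - 34 / 100 = 33%:R / 50%:R :> R by field.
  have -> : 33%:R / 50%:R / (34 / 100) = 33 / 17 :> R by field.
  by rewrite addr0; apply: powR_frac_le; [by []|lra..].
have n2R : 2 <= n%:R :> R by rewrite ler_nat.
have n0 : 0 < n%:R :> R by lra.
have p01 : 0 < p < 1 by rewrite hp; apply/andP; split; lra.
have g01 : 0 <= (121 / 100 : R) <= p^-1.
  have -> : p^-1 = 50 / 17.
    by rewrite hp; field.
  apply/andP; split; lra.
have l01 : 0 <= (2 / n%:R : R) <= 1.
  by rewrite ler_pdivrMr// mul1r n2R andbT divr_ge0// ltW.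
have half0 : 0 <= 2^-1 :> R by lra.
have half1 : 121 / 100 * 2^-1 < 1 :> R by lra.
(* Scaling by l = 2/n carries the point 1/2 to 1/n. *)
have := @defect_ge_scale R p (121 / 100) 2^-1 _ p01 g01 half0 half1 l01.
have := mulr_ge0 (sqr_ge0 (2 / n%:R)) (defect_half_ge0 R).
rewrite -hp => /le_trans H /H {H}.
have -> : 2 / n%:R * 2^-1 = n%:R^-1 :> R by field; exact: lt0r_neq0.
have scale c : 0 <= n%:R + c ->
    n%:R `^ (1 - p) * (1 + c * n%:R^-1) `^ (1 - p) = (n%:R + c) `^ (1 - p).
  move=> nc0; have nE : n%:R * (1 + c * n%:R^-1) = n%:R + c.
    by field; exact: lt0r_neq0.
  have c0 : 0 <= 1 + c * n%:R^-1 by rewrite -(pmulr_rge0 _ n0) nE.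
  by rewrite -powRM ?(ltW n0)// nE.
have scale1 : n%:R `^ (1 - p) * n%:R^-1 = n%:R `^ (- p).
  rewrite -powR_inv1 ?ltW// -powRD; first by congr (_ `^ _); ring.
  by rewrite (lt0r_neq0 n0) implybT.
(* Multiplying F(1/n) >= 0 by n^(1-p) recovers the weight condition, as r = 1/p - 1. *)
move=> /(ler_wpM2l (powR_ge0 n%:R (1 - p))).
rewrite mulr0 /defect mulrBr mulrDr mulrCA scale1 !scale; last 2 first.
- lra.
- lra.
have [n2F nS2F] : (n < 2)%N = false /\ (n.+1 < 2)%N = false.
  by split; apply/negbTE; rewrite -leqNgt ?leqW.
rewrite /weight n2F nS2F -(natr1 n).
have -> : n%:R + 1 - 121 / 100 + (1 - p) / p = n%:R + (p^-1 - 121 / 100).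
  by field; rewrite lt0r_neq0//; case/andP: p01.
lra.
Qed.

Theorem mainTheorem3 (R : realType) (p : R) (hp : p = 34 / 100)
  (a : nat -> R) (a_ge0 : forall n : nat, (1 <= n)%N -> 0 <= a n) :
  (((p / (1 - p)) `^ p)%:E * \sum_(1 <= n <oo) ((a n) `^ p)%:E
   <= \sum_(1 <= n <oo)
        ((n%:R^-1)%:E * \sum_(n <= k <oo) (a k)%:E) `^ p)%E.
Proof.
have p0 : 0 < p by lra.
have p1 : p < 1 by lra.
apply: nneseries_powR_tail_ge => [||//|N]; [exact: ltW|exact: powR_ge0|].
apply: (@sum_powR_tail_ge R p weight) => // [|n|n n1].
- by rewrite p0.
- exact: weight_ge0.
- exact: weight_step.
Qed.
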